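(* Let $F\in\mathbb{R}^{d\times d}$ be a symmetric (Fisher information) matrix with eigenvalues $0<\lambda_{\min}\le\lambda_1\le\cdots\le\lambda_d\le\lambda_{\max}$ and condition number $\kappa=\lambda_{\max}/\lambda_{\min}$. Then for any nonzero $g\in\mathbb{R}^d$, $$\cos(g,F^{-1}g)=\frac{\langle g,F^{-1}g\rangle}{\|g\|\,\|F^{-1}g\|}\ge\frac{2\sqrt{\kappa}}{\kappa+1}.$$
   Context: $\langle\cdot,\cdot\rangle$ and $\|\cdot\|$ are the Euclidean inner product and norm on $\mathbb{R}^d$. In the application $d=d_{\mathfrak g}=\dim\mathfrak{g}$ for a matrix Lie algebra $\mathfrak g$ and $F=F(\theta)$ is the Fisher information matrix of a policy; only symmetry and positive definiteness matter. *)

(* Defs.v *)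
From HB Require Import structures.
From mathcomp Require Import all_boot all_order all_algebra.
From mathcomp Require Import all_reals.

Set Implicit Arguments.
Unset Strict Implicit.
Unset Printing Implicit Defensive.

Import Order.TTheory GRing.Theory Num.Theory.
Local Open Scope ring_scope.

Definition dotv (R : realType) (d : nat) (u v : 'cV[R]_d) : R :=
  \sum_(i < d) u i 0 * v i 0.

(* The canonical norm of MathComp-Analysis on matrices is the sup norm, hence
   a separate Euclidean norm. *)
Definition normv (R : realType) (d : nat) (u : 'cV[R]_d) : R :=
  Num.sqrt (dotv u u).

Definition cosv (R : realType) (d : nat) (u v : 'cV[R]_d) : R :=
  dotv u v / (normv u * normv v).

(* Main.v *)
(** Put x = F^-1 g, m = lambda_min and M = lambda_max. Diagonalising F in a
    unitary basis over R[i], the form <(M - F) x, (F - m) x> becomes a sum of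
    terms (M - a) (a - m) |y_a|^2 over eigenvalues a, hence is nonnegative, i.e.
    (m + M) <x, F x> >= |F x|^2 + m M |x|^2; by AM-GM the right-hand side is at
    least 2 sqrt (m M) |F x| |x|. *)

Require Import Defs.
From HB Require Import structures.
From mathcomp Require Import all_boot all_order all_algebra.
From mathcomp Require Import all_reals.
From mathcomp Require Import complex ring lra.

Set Implicit Arguments.
Unset Strict Implicit.
Unset Printing Implicit Defensive.

Import Order.TTheory GRing.Theory Num.Theory.
Local Open Scope ring_scope.

Local Notation toC := (real_complex _).

(** Over [R[i]] the matrix is hermitian, so the complex spectral theorem applies; its spectrum is
    real, so taking real parts to form [D] loses nothing. *)
Lemma sym_spectral (R : rcfType) n (A : 'M[R]_n) : A^T = A ->
  exists P : 'M[R[i]]_n, exists D : 'rV[R]_n,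
  [/\ P \is unitarymx,
      P *m map_mx toC A = diag_mx (map_mx toC D) *m P
    & forall i, eigenvalue A (D 0 i)].
Proof.
move=> Asym; set AC := map_mx toC A.
have AC_real : AC \is a mxOver Num.real.
  by apply/mxOverP => i j; rewrite mxE realE !lecE /= eqxx -realE num_real.
have AC_herm : AC \is hermsymmx.
  apply: realsym_hermsym => //; apply/is_hermitianmxP.
  by rewrite expr0 scale1r map_mx_id // map_trmx Asym.
have /orthomx_spectralP AE := hermitian_normalmx AC_herm.
have Pu := spectral_unit AC.
have DE : map_mx toC (map_mx (@complex.Re R) (spectral_diag AC)) = spectral_diag AC.
  apply/matrixP => i j; rewrite !mxE.
  have /mxOverP/(_ i j) := hermitian_spectral_diag_real AC_herm.
  by case: (spectral_diag AC i j) => a b /complex_realP[c [-> ->]].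
have PA : spectralmx AC *m AC = diag_mx (spectral_diag AC) *m spectralmx AC.
  by rewrite {2}AE !mulmxA mulmxV // mul1mx.
exists (spectralmx AC), (map_mx (@complex.Re R) (spectral_diag AC)).
split; [exact: spectral_unitarymx | by rewrite DE | move=> i].
(* Eigenvectors are row vectors here: row [i] of the invertible [P] is one over [R[i]], and being an
   eigenvalue descends to [R]. *)
rewrite -(eigenvalue_map toC); apply/eigenvalueP.
exists (row i (spectralmx AC)); last first.
  apply: contraL Pu => /eqP Pi0; rewrite -row_free_unit; apply/row_freePn.
  by exists i; rewrite Pi0 sub0mx.
rewrite -row_mul PA row_mul row_diag_mx -scalemxAl -rowE; congr (_ *: _).
by rewrite -{1}DE !mxE.
Qed.

Lemma unitary_dot (C : numClosedFieldType) n (P : 'M[C]_n) (u v : 'cV[C]_n) :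
  P \is unitarymx ->
  \sum_i (P *m u) i 0 * ((P *m v) i 0)^* = \sum_i u i 0 * (v i 0)^*.
Proof.
have dotE (a b : 'cV[C]_n) :
    \sum_i a i 0 * (b i 0)^* = ((map_mx Num.conj b)^T *m a) 0 0.
  by rewrite mxE; apply: eq_bigr => i _; rewrite !mxE mulrC.
move=> /unitarymxP/mulmx1C PP.
rewrite !dotE map_mxM trmx_mul [(map_mx _ P)^T]map_trmx -mulmxA; congr ((_ *m _) 0 0).
by rewrite mulmxA PP mul1mx.
Qed.

(** Conjugation fixes real entries, so the hermitian form restricts to [dotv], and a unitary change
    of basis preserves that form. *)
Lemma dotv_unitary (R : realType) n (P : 'M[R[i]]_n) (u v : 'cV[R]_n) :
  P \is unitarymx ->
  toC (dotv u v) = \sum_i (P *m map_mx toC u) i 0 * ((P *m map_mx toC v) i 0)^*.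
Proof.
move=> Pu; rewrite unitary_dot // /dotv raddf_sum; apply: eq_bigr => i _.
by rewrite !mxE -[Num.conj _]/(conjc _) conjc_real -rmorphM.
Qed.

Lemma dotv_spectral_gap (R : realType) n (A : 'M[R]_n) (m M : R) (u : 'cV[R]_n) :
  A^T = A -> (forall a, eigenvalue A a -> m <= a <= M) ->
  0 <= dotv (M *: u - A *m u) (A *m u - m *: u).
Proof.
move=> /sym_spectral[P [D [Pu PA Deig]]] mM.
rewrite -ler0c (dotv_unitary _ _ Pu); apply: sumr_ge0 => i _.
(* Since [P] carries [A] to the diagonal [D], in the coordinates [y] of [u] the two vectors are [y]
   scaled entrywise by [M - D 0 i] and [D 0 i - m]. *)
rewrite !(map_mxB, map_mxZ, map_mxM) !(mulmxBr, mulmxA) PA -!scalemxAr -mulmxA.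
rewrite mul_diag_mx; set y := P *m _.
have /andP[mD DM] := mM _ (Deig i).
rewrite !mxE -!mulrBl rmorphM mulrACA mulr_ge0 ?mul_conjC_ge0 //.
rewrite -!rmorphB /= -[Num.conj _]/(conjc _) conjc_real -rmorphM /= ler0c.
by rewrite mulr_ge0 ?subr_ge0.
Qed.

Lemma sym_eigenvalue_exists (R : rcfType) n (A : 'M[R]_n) :
  (0 < n)%N -> A^T = A -> exists a, eigenvalue A a.
Proof.
move=> n_gt0 /sym_spectral[P [D [_ _ Deig]]].
by exists (D 0 (Ordinal n_gt0)); exact: Deig.
Qed.

Lemma dotv_gt0 (R : realType) n (u : 'cV[R]_n) : u != 0 -> 0 < dotv u u.
Proof.
move=> u0; have sq_ge0 (i : 'I_n) : true -> 0 <= u i 0 * u i 0.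
  by rewrite -expr2 sqr_ge0.
rewrite lt_neqAle eq_sym sumr_ge0 // andbT.
apply: contra u0 => /eqP/(psumr_eq0P sq_ge0) u_eq0.
apply/eqP/matrixP => i j; rewrite ord1 mxE; apply/eqP.
by rewrite -sqrf_eq0 expr2 u_eq0.
Qed.

Lemma normv_gt0 (R : realType) n (u : 'cV[R]_n) : u != 0 -> 0 < normv u.
Proof. by move=> u0; rewrite sqrtr_gt0 dotv_gt0. Qed.

Lemma sqr_normv (R : realType) n (u : 'cV[R]_n) : normv u ^+ 2 = dotv u u.
Proof.
by rewrite sqr_sqrtr // sumr_ge0 // => i _; rewrite -expr2 sqr_ge0.
Qed.

Theorem proposition15p1 (R : realType) (d : nat) (F : 'M[R]_d)
    (lambda_min lambda_max : R)
    (F_sym : F^T = F)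
    (lambda_min_gt0 : 0 < lambda_min)
    (F_spectrum : forall a : R, eigenvalue F a -> lambda_min <= a <= lambda_max)
    (g : 'cV[R]_d) (g_neq0 : g != 0) :
  let kappa := lambda_max / lambda_min in
  cosv g (invmx F *m g) >= 2 * Num.sqrt kappa / (kappa + 1).
Proof.
move: lambda_min lambda_max lambda_min_gt0 F_spectrum => m M m_gt0 F_spectrum /=.
set kappa := M / m.
have d_gt0 : (0 < d)%N.
  by case: d g g_neq0 {F F_sym F_spectrum} => // g; rewrite flatmx0 eqxx.
(* The spectral bounds give [m <= M] only through an actual eigenvalue. Nonnegativity matters
   because [Num.sqrt] is 0 on negative numbers. *)
have kappa_ge0 : 0 <= kappa.
  have [a /F_spectrum/andP[ma aM]] := sym_eigenvalue_exists d_gt0 F_sym.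
  by apply: divr_ge0; lra.
(* A nontrivial kernel would make 0 an eigenvalue, against [0 < m]. *)
have F_unit : F \in unitmx.
  rewrite -row_free_unit -kermx_eq0; apply/negPn/negP => kF0.
  have /F_spectrum/andP[m0 _] : eigenvalue F 0.
    by rewrite /eigenvalue /eigenspace raddf0 subr0.
  by move: m0; rewrite leNgt m_gt0.
set x := invmx F *m g.
have Fx : F *m x = g by rewrite mulmxA mulmxV // mul1mx.
have x_neq0 : x != 0 by apply: contraNneq g_neq0 => x0; rewrite -Fx x0 mulmx0.
have := dotv_spectral_gap x F_sym F_spectrum; rewrite Fx.
have -> : dotv (M *: x - g) (g - m *: x)
    = (m + M) * dotv g x - dotv g g - m * M * dotv x x.
  rewrite /dotv !mulr_sumr -!sumrB; apply: eq_bigr => i _; rewrite !mxE; ring.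
rewrite -!sqr_normv /cosv.
have := normv_gt0 x_neq0; have := normv_gt0 g_neq0.
move: (normv x) (normv g) (dotv g x) => X G c G0 X0.
(* With [k] the square root of [kappa], the gap reads [m * (1 + k^2) * c >= G^2 + (m * k * X)^2]. *)
have -> : M = m * kappa by rewrite /kappa mulrC divfK // gt_eqF.
rewrite -[kappa in m * kappa]sqr_sqrtr // -[kappa in kappa + 1]sqr_sqrtr //.
have := sqrtr_ge0 kappa; move: (Num.sqrt kappa) => k k0 gap.
rewrite ler_pdivrMr; last by nra.
rewrite mulrAC ler_pdivlMr; last exact: mulr_gt0.
rewrite -(ler_pM2l m_gt0).
(* AM-GM for [G] and [m * k * X], where [m * k] is the square root of [m * M]. *)
have := sqr_ge0 (G - m * k * X); lra.
Qed.
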